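(* Let $p$ be a prime. For each $n\ge2$ let $f\in\mathbb{Z}_p[x_0,\dots,x_n]$ be a random homogeneous polynomial of degree $2n-3$ sampled from the uniform distribution. Then $$\limsup_{n\to\infty}\mathbb{E}\,\#\{\text{lines on }Z(f)\subset\mathbb{Q}_p\mathrm{P}^n\}\le\frac{1}{\lambda(\mathrm{GL}_2(\mathbb{Z}_p))}.$$
   Context: $\lambda$ is the Haar measure on $\mathbb{Q}_p^N$ normalized by $\lambda(\mathbb{Z}_p^N)=1$; the set $\mathrm{GL}_2(\mathbb{Z}_p)$ is viewed as a subset of $\mathbb{Z}_p^{2\times2}\cong\mathbb{Z}_p^4$, and $\lambda(\mathrm{GL}_2(\mathbb{Z}_p))=(1-\tfrac1p)(1-\tfrac1{p^2})$. The uniform distribution on homogeneous polynomials of degree $d$ in $x_0,\dots,x_n$ over $\mathbb{Z}_p$ is the law of $f=\sum_{|\alpha|=d}\xi_\alpha x_0^{\alpha_0}\cdots x_n^{\alpha_n}$ with $\xi_\alpha$ i.i.d. uniform (Haar-distributed) in $\mathbb{Z}_p$. A line in $\mathbb{Q}_p\mathrm{P}^n$ is $P(L)$ with $L\subset\mathbb{Q}_p^{n+1}$ a $2$-dimensional linear subspace; it lies on $Z(f)$ if $f|_L=0$. *)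

(* Defs.v *)
From HB Require Import structures.
From mathcomp Require Import all_boot all_order all_algebra.
From mathcomp Require Import all_classical all_reals all_analysis.
(* The notations of mpoly clash with those of MathComp-Analysis. *)
From mathcomp Require Import -(notations) mpoly.
Set Implicit Arguments.
Unset Strict Implicit.
Unset Printing Implicit Defensive.
Import Order.TTheory GRing.Theory Num.Theory.
Local Open Scope classical_set_scope.
Local Open Scope ring_scope.

(* Z_p as the inverse limit of the Z/p^k: [zres x k] is the representative in
   {0, ..., p^k - 1} of the residue class of x mod p^k. *)
Record Zpadic (p : nat) (p_pr : prime p) := MkZpadic {
  zres : nat -> int;
  _ : `[< forall k, zres k = (zres k.+1 %% (p ^ k)%N%:Z)%Z >] }.

Section PadicIntegers.
Variables (p : nat) (p_pr : prime p).
Notation Zp := (Zpadic p_pr).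

HB.instance Definition _ := [isSub of Zp for @zres p p_pr].
HB.instance Definition _ := [Choice of Zp by <:].

Let q (k : nat) : int := (p ^ k)%N%:Z.

Let q_neq0 k : q k != 0.
Proof. by rewrite /q eqz_nat -lt0n expn_gt0 prime_gt0. Qed.

Let q_dvd k : (q k %| q k.+1)%Z.
Proof. by rewrite /q expnS PoszM dvdz_mull. Qed.

Let modq k x : ((x %% q k.+1)%Z %% q k)%Z = (x %% q k)%Z.
Proof.
rewrite [in RHS](divz_eq x (q k.+1)).
have /dvdzP[c ->] := q_dvd k.
by rewrite mulrA modzMDl.
Qed.

Lemma zresS (x : Zp) k : (zres x k.+1 %% (p ^ k)%N%:Z)%Z = zres x k.
Proof. by case: x => x /= /asboolP/(_ k). Qed.

Lemma zres_mod (x : Zp) k : (zres x k %% (p ^ k)%N%:Z)%Z = zres x k.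
Proof. by rewrite -[in LHS]zresS modz_mod zresS. Qed.

Lemma Zpadic_eqP (x y : Zp) : (forall k, zres x k = zres y k) -> x = y.
Proof. by move=> xy; apply/val_inj/funext. Qed.

(* [coh u]: the u k represent compatible residue classes mod p^k, without
   being reduced. *)
Let coh (u : nat -> int) :=
  forall k, (u k = u k.+1 %[mod (p ^ k)%N%:Z])%Z.

Let mk (u : nat -> int) (hu : coh u) : Zp.
Proof.
apply: (@MkZpadic p p_pr (fun k => (u k %% (p ^ k)%N%:Z)%Z)).
by apply/asboolP => k; rewrite -/(q k) -/(q k.+1) modq hu.
Defined.

Let coh_zres (x : Zp) : coh (zres x).
Proof. by move=> k; rewrite -[in LHS]zresS modz_mod. Qed.

Let coh_cst c : coh (fun=> c). Proof. by []. Qed.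

Let cohD u v : coh u -> coh v -> coh (fun k => u k + v k).
Proof. by move=> hu hv k; rewrite -modzDm hu hv modzDm. Qed.

Let cohM u v : coh u -> coh v -> coh (fun k => u k * v k).
Proof. by move=> hu hv k; rewrite -modzMm hu hv modzMm. Qed.

Let cohN u : coh u -> coh (fun k => - u k).
Proof. by move=> hu k; rewrite -modzNm hu modzNm. Qed.

Definition Zpadic_cst c : Zp := mk (coh_cst c).
Definition Zpadic_add (x y : Zp) : Zp := mk (cohD (coh_zres x) (coh_zres y)).
Definition Zpadic_mul (x y : Zp) : Zp := mk (cohM (coh_zres x) (coh_zres y)).
Definition Zpadic_opp (x : Zp) : Zp := mk (cohN (coh_zres x)).

Let addA : associative Zpadic_add.
Proof. by move=> x y z; apply: Zpadic_eqP => k /=; rewrite modzDml modzDmr addrA. Qed.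

Let addC : commutative Zpadic_add.
Proof. by move=> x y; apply: Zpadic_eqP => k /=; rewrite addrC. Qed.

Let add0 : left_id (Zpadic_cst 0) Zpadic_add.
Proof. by move=> x; apply: Zpadic_eqP => k /=; rewrite modzDml add0r zres_mod. Qed.

Let addN : left_inverse (Zpadic_cst 0) Zpadic_opp Zpadic_add.
Proof. by move=> x; apply: Zpadic_eqP => k /=; rewrite modzDml addNr. Qed.

HB.instance Definition _ := GRing.isZmodule.Build Zp addA addC add0 addN.

Let mulA : associative Zpadic_mul.
Proof. by move=> x y z; apply: Zpadic_eqP => k /=; rewrite modzMml modzMmr mulrA. Qed.

Let mulC : commutative Zpadic_mul.
Proof. by move=> x y; apply: Zpadic_eqP => k /=; rewrite mulrC. Qed.

Let mul1 : left_id (Zpadic_cst 1) Zpadic_mul.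
Proof. by move=> x; apply: Zpadic_eqP => k /=; rewrite modzMml mul1r zres_mod. Qed.

Let mulD : left_distributive Zpadic_mul Zpadic_add.
Proof.
by move=> x y z; apply: Zpadic_eqP => k /=; rewrite modzMml modzDml modzDmr mulrDl.
Qed.

Let one_neq0 : Zpadic_cst 1 != Zpadic_cst 0.
Proof.
apply/eqP => /(congr1 (fun x => zres x 1)) /=.
rewrite expn1 mod0z modz_small //=.
by rewrite ltz_nat prime_gt1.
Qed.

HB.instance Definition _ :=
  GRing.Zmodule_isComNzRing.Build Zp mulA mulC mul1 mulD one_neq0.

Let unitZ : {pred Zp} := fun x => `[< exists y, y * x = 1 >].

Let invZ (x : Zp) : Zp := if pselect (exists y, y * x = 1) is left h
  then projT1 (cid h) else x.

Let mulVx : {in unitZ, left_inverse 1 invZ *%R}.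
Proof.
move=> x /asboolP ux; rewrite /invZ; case: pselect => // h.
exact: (projT2 (cid h)).
Qed.

Let unitPl (x y : Zp) : y * x = 1 -> unitZ x.
Proof. by move=> yx; apply/asboolP; exists y. Qed.

Let inv_out : {in [predC unitZ], invZ =1 id}.
Proof. by move=> x /asboolP nux; rewrite /invZ; case: pselect. Qed.

HB.instance Definition _ :=
  GRing.ComNzRing_hasMulInverse.Build Zp mulVx unitPl inv_out.

Let zres_le (x : Zp) k m : (k <= m)%N ->
  (zres x m %% (p ^ k)%N%:Z)%Z = zres x k.
Proof.
move=> /subnK <-; elim: (m - k)%N => [|i IH]; first by rewrite zres_mod.
rewrite addSn -[RHS]IH -(zresS x (i + k)).
rewrite expnD PoszM [in LHS](divz_eq (zres x (i + k).+1) (p ^ i * p ^ k)%N%:Z).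
by rewrite PoszM mulrA modzMDl.
Qed.

Let zres_logn (x : Zp) k m : (k <= m)%N -> zres x k != 0 ->
  (0 < `|zres x m|)%N /\ (logn p `|zres x m| < k)%N.
Proof.
move=> km xk.
have xm : (0 < `|zres x m|)%N.
  rewrite absz_gt0; apply: contraNneq xk => xm0.
  by rewrite -(zres_le x km) xm0 mod0z.
split=> //; rewrite ltnNge; apply: contraNN xk => kl.
rewrite -(zres_le x km); apply/eqP/eqP; rewrite -/(dvdz _ _).
have : (p ^ k %| `|zres x m|)%N by rewrite pfactor_dvdn.
by move=> h; apply/eqP/dvdz_mod0P.
Qed.

Let mulf_eq0 : GRing.integral_domain_axiom Zp.
Proof.
move=> x y xy0; have [//|x0] := eqVneq x 0; have [//|y0] := eqVneq y 0.
exfalso.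
have nz (z : Zp) : z != 0 -> exists k, zres z k != 0.
  move=> z0; apply: contrapT => h; case/eqP: z0.
  apply: Zpadic_eqP => k /=; rewrite mod0z.
  by apply: contrapT => /eqP zk; apply: h; exists k.
have [k xk] := nz _ x0; have [l yl] := nz _ y0.
have [xm Lx] := zres_logn (leq_addr l k) xk.
have [ym Ly] := zres_logn (leq_addl k l) yl.
have /dvdz_mod0P : (zres x (k + l) * zres y (k + l) %% (p ^ (k + l))%N%:Z)%Z = 0.
  by have := congr1 (fun z => zres z (k + l)) xy0; rewrite /= mod0z.
rewrite dvdzE abszM /= pfactor_dvdn ?muln_gt0 ?xm //.
rewrite lognM // leqNgt => /negP; apply.
by rewrite -addnS leq_add // ltnW.
Qed.

HB.instance Definition _ := GRing.ComUnitRing_isIntegral.Build Zp mulf_eq0.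
HB.instance Definition _ := isPointed.Build Zp 0.

End PadicIntegers.

Definition Qpadic (p : nat) (p_pr : prime p) : Type := {fraction Zpadic p_pr}.

HB.instance Definition _ p (p_pr : prime p) := GRing.Field.on (Qpadic p_pr).
HB.instance Definition _ p (p_pr : prime p) := isPointed.Build (Qpadic p_pr) 0.

Definition Zpadic_inc p (p_pr : prime p) : {rmorphism Zpadic p_pr -> Qpadic p_pr} :=
  @FracField.tofrac (Zpadic p_pr).

(* The p-adic topology: the sets x + p^k Z_p form a basis of neighbourhoods of
   x, in Z_p itself ([f] the identity) and in Q_p ([f] the embedding). *)
Definition padic_open p (p_pr : prime p) (T : comNzRingType)
    (f : {rmorphism Zpadic p_pr -> T}) : set (set T) :=
  [set U | forall x, U x -> exists k : nat, forall z, U (x + p%:R ^+ k * f z)].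

Section PadicTopology.
Variables (p : nat) (p_pr : prime p) (T : comNzRingType).
Variable f : {rmorphism Zpadic p_pr -> T}.

Lemma padic_openT : padic_open f setT.
Proof. by move=> x _; exists 0%N. Qed.

Lemma padic_openI : setI_closed (padic_open f).
Proof.
move=> U V oU oV x [/oU[k Uk] /oV[l Vl]]; exists (k + l)%N => z; split.
  by have := Uk (p%:R ^+ l * z); rewrite rmorphM rmorphXn rmorph_nat exprD mulrA.
have := Vl (p%:R ^+ k * z).
by rewrite rmorphM rmorphXn rmorph_nat addnC exprD mulrA.
Qed.

Lemma padic_open_bigU (I : Type) (U : I -> set T) :
  (forall i, padic_open f (U i)) -> padic_open f (\bigcup_i U i).
Proof.
move=> oU x [i _ /(oU i)[k Uk]]; exists k => z.
by exists i => //; exact: Uk.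
Qed.

End PadicTopology.

HB.instance Definition _ p (p_pr : prime p) :=
  isOpenTopological.Build (Zpadic p_pr) (padic_openT (@idfun (Zpadic p_pr)))
    (@padic_openI _ _ _ (@idfun (Zpadic p_pr)))
    (@padic_open_bigU _ _ _ (@idfun (Zpadic p_pr))).

HB.instance Definition _ p (p_pr : prime p) :=
  isOpenTopological.Build (Qpadic p_pr) (padic_openT (Zpadic_inc p_pr))
    (@padic_openI _ _ _ (Zpadic_inc p_pr)) (@padic_open_bigU _ _ _ (Zpadic_inc p_pr)).

Definition borel (T : ptopologicalType) := g_sigma_algebraType (@open T).

(* A translation-invariant Borel measure normalized on a compact neighbourhood
   K of 0 is the corresponding normalized Haar measure; local finiteness and
   regularity are automatic on the spaces Z_p and Q_p^N. *)
Definition haar_measure (R : realType) (V : zmodType) (B : set (set V))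
    (K : set V) (mu : set V -> \bar R) : Prop :=
  mu K = 1%:E /\ forall (a : V) (A : set V), B A -> mu [set a + x | x in A] = mu A.

(* The bound d.+1 is implied by the degree; it only makes the type finite. *)
Definition hom_monom n d := {m : bmultinom n d.+1 | mdeg m == d}.

HB.instance Definition _ n d := Finite.on (hom_monom n d).

Section RandomPolynomials.
Variables (p : nat) (p_pr : prime p).
Notation Zp := (Zpadic p_pr).
Notation Qp := (Qpadic p_pr).

Definition integral_mx m n : set 'M[Qp]_(m, n) :=
  range (fun A : 'M[Zp]_(m, n) => map_mx (Zpadic_inc p_pr) A).

Definition GL_padic n : set 'M[Qp]_n :=
  [set map_mx (Zpadic_inc p_pr) A | A in [set A : 'M[Zp]_n | A \in unitmx]].

Definition hom_poly n d (xi : hom_monom n d -> Zp) : mpoly n Zp :=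
  \sum_(alpha : hom_monom n d)
     xi alpha *: mpolyX Zp (val alpha).

(* A line P(L) is represented by the plane L. *)
Definition lines_on n (f : mpoly n.+1 Zp) : set {vspace 'rV[Qp]_n.+1} :=
  [set L | \dim L = 2%N /\ forall v : 'rV[Qp]_n.+1, v \in L ->
     meval (fun i => v 0 i) (map_mpoly (Zpadic_inc p_pr) f) = 0].

End RandomPolynomials.

Section Independence.
Variables (d d' : measure_display) (Omega : measurableType d).
Variables (E : measurableType d') (R : realType) (P : probability Omega R).

Definition mutually_independent (I : finType) (X : I -> {RV P >-> E}) : Prop :=
  forall (J : {set I}) (A : I -> set E),
    (forall i, i \in J -> measurable (A i)) ->
    P (\bigcap_(i in [set` J]) (X i @^-1` A i)) =
      (\prod_(i in J) P (X i @^-1` A i))%E.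

End Independence.

Section Uniform.
Variables (p : nat) (p_pr : prime p).
Variables (d : measure_display) (Omega : measurableType d).
Variables (R : realType) (P : probability Omega R).

Definition iid_uniform (I : finType) (xi : I -> {RV P >-> borel (Zpadic p_pr)}) :=
  mutually_independent xi /\
  forall i, haar_measure (measurable : set (set (borel (Zpadic p_pr)))) setT
              (distribution P (xi i)).

End Uniform.

(* Main.v *)
(* For q = p^(k+1) let N_k(f) be the number of 2 x (n+1) matrices A over Z/q
   with a right inverse such that f vanishes mod q on the pencil spanned by the
   rows of A, divided by #GL_2(Z/q).  A line on Z(f) has a basis over Z_p with a
   2 x 2 identity minor; the reduction of this basis has a free GL_2(Z/q)-orbit
   counted by N_k(f), and distinct lines have disjoint orbits for k large.
   Hence the number of lines is at most liminf_k N_k(f).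

   Restriction to a right-invertible pencil maps forms of degree d = 2n-3 onto
   binary forms of degree d, so f vanishes on it mod q with probability at most
   q^-(d+1).  There are at most q^(2(n+1)) such pencils, so
   E N_k <= q^4 / #GL_2(Z/q) = 1 / lambda(GL_2(Z_p)) for every k and n >= 2, and
   the theorem follows from Fatou's lemma. *)

From HB Require Import structures.
Require Import Defs.
From mathcomp Require Import all_boot all_order all_algebra.
From mathcomp Require Import all_classical all_reals all_analysis.
From mathcomp Require Import measurable_realfun finmap zify.
From mathcomp Require Import -(notations) mpoly.
Set Implicit Arguments.
Unset Strict Implicit.
Unset Printing Implicit Defensive.
Import Order.TTheory GRing.Theory Num.Theory.
Local Open Scope classical_set_scope.
Local Open Scope ring_scope.

(** * Arithmetic of Z_p and its reductions mod p^(k+1) *)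

Lemma fraction_num_den (R : idomainType) (z : {fraction R}) :
  exists2 a, a != 0 & exists b, FracField.tofrac a * z = FracField.tofrac b.
Proof.
have [x ->] : exists x : {ratio R}, z = (\pi_{fraction R} x)%qT.
  by exists (repr z); rewrite reprK.
exists (frac x).2; first exact: denom_ratioP.
exists (frac x).1; unlock FracField.tofrac.
rewrite -[LHS]FracField.pi_mul; apply/eqmodP; rewrite /= FracField.equivfE.
by rewrite /FracField.mulf !numden_Ratio ?mul1r ?oner_neq0 ?denom_ratioP // mulr1 mulrC.
Qed.

Section PadicArithmetic.
Variables (p : nat) (p_pr : prime p).
Notation Zp := (Zpadic p_pr).
Implicit Types (x y : Zp) (k : nat).

Lemma expn_prime_gt1 k : (1 < p ^ k.+1)%N.
Proof. by rewrite -(exp1n k.+1) ltn_exp2r // prime_gt1. Qed.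

Lemma zresD x y k :
  zres (x + y) k = ((zres x k + zres y k) %% (p ^ k)%N%:Z)%Z.
Proof. by []. Qed.

Lemma zresM x y k :
  zres (x * y) k = ((zres x k * zres y k) %% (p ^ k)%N%:Z)%Z.
Proof. by []. Qed.

Lemma zres1 k : zres (1 : Zp) k = (1 %% (p ^ k)%N%:Z)%Z.
Proof. by []. Qed.

Lemma zres0 k : zres (0 : Zp) k = 0.
Proof. by rewrite [LHS](mod0z). Qed.

Lemma zres_nat n k : zres (n%:R : Zp) k = (n%:Z %% (p ^ k)%N%:Z)%Z.
Proof.
elim: n => [|n IH]; first by rewrite zres0 mod0z.
by rewrite mulrS zresD zres1 IH modzDml modzDmr -PoszD.
Qed.

Lemma ltz_prime_exp k : 0 < (p ^ k)%N%:Z.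
Proof. by rewrite ltz_nat expn_gt0 prime_gt0. Qed.

Lemma zres_ge0 x k : 0 <= zres x k.
Proof. by rewrite -zres_mod modz_ge0 // gt_eqF // ltz_prime_exp. Qed.

Lemma zres_lt x k : zres x k < (p ^ k)%N%:Z.
Proof. by rewrite -zres_mod ltz_pmod // ltz_prime_exp. Qed.

Lemma modz_prime_exp (a : int) k m : (k <= m)%N ->
  ((a %% (p ^ m)%N%:Z)%Z %% (p ^ k)%N%:Z)%Z = (a %% (p ^ k)%N%:Z)%Z.
Proof.
move=> km; rewrite [in RHS](divz_eq a (p ^ m)%N%:Z).
by rewrite -(subnK km) expnD PoszM mulrA modzMDl.
Qed.

Lemma zres_le x k m : (k <= m)%N ->
  (zres x m %% (p ^ k)%N%:Z)%Z = zres x k.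
Proof.
move=> /subnK <-; elim: (m - k)%N => [|i IH]; first by rewrite zres_mod.
by rewrite addSn -[RHS]IH -(zresS x (i + k)) modz_prime_exp // leq_addl.
Qed.

(** Builds elements from compatible but unreduced residues, such as the Bezout coefficients and the
    quotients below. *)
Lemma Zpadic_of_seq (u : nat -> int) :
    (forall k, (u k = u k.+1 %[mod (p ^ k)%N%:Z])%Z) ->
  exists x, forall k, zres x k = (u k %% (p ^ k)%N%:Z)%Z.
Proof.
move=> hu; suff h : `[< forall k, (u k %% (p ^ k)%N%:Z)%Z =
    ((u k.+1 %% (p ^ k.+1)%N%:Z)%Z %% (p ^ k)%N%:Z)%Z >].
  by exists (@MkZpadic p p_pr (fun k => (u k %% (p ^ k)%N%:Z)%Z) h).
by apply/asboolP => k; rewrite modz_prime_exp.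
Qed.

(** A nonzero residue mod p is prime to p, so Bezout inverts [x] mod every p^k. Inverses are unique
    mod p^k, hence compatible. *)
Lemma Zpadic_unitP x : reflect (zres x 1 <> 0) (x \is a GRing.unit).
Proof.
apply: (iffP idP) => [ux x1|/eqP x1].
  have := congr1 (fun z => zres z 1) (mulVr ux).
  rewrite zresM x1 mulr0 mod0z zres1 expn1 modz_small //=.
  by rewrite ltz_nat prime_gt1.
have inv k : exists y : int, (y * zres x k = 1 %[mod (p ^ k)%N%:Z])%Z.
  have cop : coprimez (zres x k) (p ^ k)%N%:Z.
    rewrite /coprimez; case: k => [|k]; first by rewrite expn0 gcdz1.
    rewrite -/(coprimez _ _) coprimezE /= coprimeXr // coprime_sym.
    rewrite prime_coprime //; apply: contra x1 => px.
    rewrite -(zres_le x (ltn0Sn k)) expn1.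
    by apply/eqP/dvdz_mod0P; rewrite dvdzE.
  have [u [v uv]] := Bezoutz (zres x k) (p ^ k)%N%:Z.
  exists u; rewrite (eqP cop) in uv; rewrite -uv.
  by rewrite addrC modzMDl.
have [u hu] := choice inv.
have cu k : (u k = u k.+1 %[mod (p ^ k)%N%:Z])%Z.
  have h : (u k.+1 * zres x k = 1 %[mod (p ^ k)%N%:Z])%Z.
    rewrite -zresS modzMmr -(@modz_prime_exp (_ * _) k k.+1) //.
    by rewrite hu modz_prime_exp.
  rewrite -[u k]mulr1 -modzMmr -h modzMmr mulrCA -modzMmr.
  by rewrite hu modzMmr mulr1.
have [y hy] := Zpadic_of_seq cu.
apply/unitrPr; exists y; apply: Zpadic_eqP => k.
by rewrite zresM hy modzMmr mulrC hu zres1.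
Qed.

(** [v] is the valuation: [v.+1] is the first precision at which the residue of [x] is nonzero. *)
Lemma Zpadic_factor x : x != 0 ->
  exists v, exists2 u, u \is a GRing.unit & x = p%:R ^+ v * u.
Proof.
move=> x0.
have [v xv vmin] : exists2 v, zres x v.+1 != 0 & zres x v = 0.
  have ex : exists k, zres x k != 0.
    apply: contrapT => h; case/eqP: x0; apply: Zpadic_eqP => k.
    rewrite zres0; apply: contrapT => /eqP xk; apply: h; by exists k.
  case: (ex_minnP ex) => -[|v] xv vmin.
    by move: xv; rewrite -zres_mod expn0 modz1 eqxx.
  exists v => //; apply/eqP; apply: contraT => /vmin.
  by rewrite ltnn.
have dv k : ((p ^ v)%N%:Z %| zres x (k + v))%Z.
  by apply/dvdz_mod0P; rewrite zres_le ?leq_addl.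
have pv0 : (p ^ v)%N%:Z != 0 by rewrite gt_eqF // ltz_prime_exp.
(* Division by p^v loses [v] digits, so the unit mod p^k is read from [x] mod p^(k+v). *)
pose u k := (zres x (k + v) %/ (p ^ v)%N%:Z)%Z.
have uE k : u k * (p ^ v)%N%:Z = zres x (k + v) by rewrite /u divzK.
have cu k : (u k = u k.+1 %[mod (p ^ k)%N%:Z])%Z.
  apply: (@mulIf _ (p ^ v)%N%:Z) => //.
  rewrite !mulz_modl ?ltz_prime_exp // !uE -PoszM -expnD addSn.
  by rewrite zresS zres_mod.
have [y hy] := Zpadic_of_seq cu.
exists v, y; last first.
  apply: Zpadic_eqP => k; rewrite zresM -natrX zres_nat hy modzMml modzMmr.
  by rewrite mulrC uE zres_le ?leq_addr.
apply/Zpadic_unitP; rewrite hy expn1 => /dvdz_mod0P/dvdzP[c uc].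
case/eqP: xv; rewrite -(zres_mod x) -[in LHS]add1n -uE uc add1n.
by rewrite expnS PoszM -mulrA modzMl.
Qed.

Lemma Zpadic_dvd_total x y : (exists z, y = z * x) \/ (exists z, x = z * y).
Proof.
have [->|x0] := eqVneq x 0; first by right; exists 0; rewrite mul0r.
have [->|y0] := eqVneq y 0; first by left; exists 0; rewrite mul0r.
have [v [a ua ->]] := Zpadic_factor x0; have [w [b ub ->]] := Zpadic_factor y0.
wlog vw : v w a b ua ub / (v <= w)%N.
  move=> H; case/orP: (leq_total v w) => vw; first exact: H.
  by case: (H w v b a ub ua vw) => h; [right|left].
left; exists (p%:R ^+ (w - v) * (b / a)).
by rewrite mulrACA divrK // -exprD subnK.
Qed.

(** Some member of the family has least valuation. The family will be that of the maximal minors of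
    a matrix. *)
Lemma Zpadic_dvd_all (I : finType) (F : I -> Zp) : (exists i, F i != 0) ->
  exists2 i, F i != 0 & forall j, exists z, F j = z * F i.
Proof.
move=> [i0 Fi0].
suff H (s : seq I) : exists2 i, F i != 0 & {in s, forall j, exists z, F j = z * F i}.
  have [i Fi hi] := H (enum I); exists i => // j.
  by apply: hi; rewrite mem_enum.
elim: s => [|a s [i Fi hi]]; first by exists i0.
have [[z Fa]|[z Fiz]] := Zpadic_dvd_total (F i) (F a).
  exists i => // j; rewrite inE => /orP[/eqP->|]; last exact: hi.
  by exists z.
exists a; first by apply: contraNneq Fi => Fa0; rewrite Fiz Fa0 mulr0.
move=> j; rewrite inE => /orP[/eqP->|/hi[y Fj]]; first by exists 1; rewrite mul1r.
by exists (y * z); rewrite Fj Fiz mulrA.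
Qed.

Notation W k := 'Z_(p ^ k.+1).

Lemma intr_Zp_mod k (a : int) : (a %% (p ^ k.+1)%N%:Z)%Z%:~R = a%:~R :> W k.
Proof.
rewrite [a in RHS](divz_eq a (p ^ k.+1)%N%:Z) [RHS]intrD intrM.
have -> : (p ^ k.+1)%N%:Z%:~R = 0 :> W k := pchar_Zp (expn_prime_gt1 k).
by rewrite mulr0 add0r.
Qed.

(** The exponent [k.+1] keeps the modulus above 1: the type ['Z_1] has two elements. *)
Definition Zpadic_red k x : W k := (zres x k.+1)%:~R.

Lemma Zpadic_red_is_zmod_morphism k : zmod_morphism (@Zpadic_red k).
Proof.
move=> x y; apply: (addIr (Zpadic_red k y)); rewrite subrK.
by rewrite /Zpadic_red -intrD -intr_Zp_mod -zresD subrK.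
Qed.

Lemma Zpadic_red_is_monoid_morphism k : monoid_morphism (@Zpadic_red k).
Proof.
split=> [|x y]; first by rewrite /Zpadic_red zres1 intr_Zp_mod.
by rewrite /Zpadic_red zresM intr_Zp_mod intrM.
Qed.

HB.instance Definition _ k := GRing.isZmodMorphism.Build Zp (W k)
  (@Zpadic_red k) (@Zpadic_red_is_zmod_morphism k).
HB.instance Definition _ k := GRing.isMonoidMorphism.Build Zp (W k)
  (@Zpadic_red k) (@Zpadic_red_is_monoid_morphism k).

Lemma Zpadic_red_inj k x y :
  Zpadic_red k x = Zpadic_red k y -> zres x k.+1 = zres y k.+1.
Proof.
have := zres_lt x k.+1; have := zres_ge0 x k.+1; rewrite /Zpadic_red.
have := zres_lt y k.+1; have := zres_ge0 y k.+1.
case: (zres x k.+1) => // a; case: (zres y k.+1) => // b _ bq _ aq /(congr1 val).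
by rewrite /= !val_Zp_nat ?expn_prime_gt1 // !modn_small // => ->.
Qed.

Lemma Zpadic_red_surj k (w : W k) : exists x, Zpadic_red k x = w.
Proof. by exists (val w)%:R; rewrite rmorph_nat natr_Zp. Qed.

Lemma Zpadic_red_le k m x y : (k <= m)%N ->
  Zpadic_red m x = Zpadic_red m y -> Zpadic_red k x = Zpadic_red k y.
Proof.
move=> km /Zpadic_red_inj xy; rewrite /Zpadic_red.
by rewrite -(@zres_le x _ m.+1) // xy zres_le.
Qed.

Lemma Zpadic_red_neq x y : x != y -> exists k, Zpadic_red k x != Zpadic_red k y.
Proof.
move=> xy; apply: contrapT => h; case/eqP: xy; apply: Zpadic_eqP => k.
rewrite -!(zres_le _ (leqnSn k)) (@Zpadic_red_inj k x y) //.
by apply: contrapT => /eqP ?; apply: h; exists k.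
Qed.

Lemma Zpadic_red_unit k x : (Zpadic_red k x \is a GRing.unit) = (x \is a GRing.unit).
Proof.
apply/idP/idP => [/unitrPr[w]|]; last exact: rmorph_unit.
have [y <-] := Zpadic_red_surj w; rewrite -rmorphM -(rmorph1 (@Zpadic_red k)) => xy.
have : x * y \is a GRing.unit.
  apply/Zpadic_unitP; rewrite -(@zres_le _ 1 k.+1) // (Zpadic_red_inj xy).
  rewrite zres_le // zres1 expn1 modz_small //.
  by rewrite ltz_nat prime_gt1.
by rewrite unitrM => /andP[].
Qed.

Lemma Zpadic_red_expn k z : Zpadic_red k (p%:R ^+ k.+1 * z) = 0.
Proof.
by rewrite rmorphM rmorphXn rmorph_nat -natrX pchar_Zp ?expn_prime_gt1 // mul0r.
Qed.

Lemma card_Zpadic_red k : #|{: W k}| = (p ^ k.+1)%N.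
Proof. by rewrite card_ord Zp_cast // expn_prime_gt1. Qed.

Lemma Zpadic_inc_inj : injective (Zpadic_inc p_pr).
Proof. by move=> x y /eqP; rewrite tofrac_eq => /eqP. Qed.

Lemma Qpadic_frac (z : Qpadic p_pr) :
  exists2 a, a != 0 & exists b, Zpadic_inc p_pr a * z = Zpadic_inc p_pr b.
Proof. exact: fraction_num_den. Qed.

End PadicArithmetic.

(** * Saturated integral bases of subspaces *)

Section SaturatedBases.
Variables (p : nat) (p_pr : prime p).
Notation Zp := (Zpadic p_pr).
Notation Qp := (Qpadic p_pr).
Notation inc := (Zpadic_inc p_pr).

Lemma clear_denominators m n (M : 'M[Qp]_(m, n)) :
  exists2 a, a != 0 & exists N : 'M[Zp]_(m, n), inc a *: M = map_mx inc N.
Proof.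
have h (ij : 'I_m * 'I_n) : exists ab : Zp * Zp,
    ab.1 != 0 /\ inc ab.1 * M ij.1 ij.2 = inc ab.2.
  by have [a a0 [b ab]] := Qpadic_frac (M ij.1 ij.2); exists (a, b).
have [f hf] := choice h.
exists (\prod_ij (f ij).1).
  by rewrite prodf_seq_neq0; apply/allP => ij _; case: (hf ij).
exists (\matrix_(i, j) ((\prod_(kl | kl != (i, j)) (f kl).1) * (f (i, j)).2)).
apply/matrixP => i j; rewrite !mxE (bigD1 (i, j)) //= !rmorphM.
by have [_ /= <-] := hf (i, j); rewrite mulrCA mulrA.
Qed.

(** Cramer's rule: expanding the substituted minor along column [i] involves only cofactors of the
    original one. *)
Lemma det_colsub_subst (R : comNzRingType) m n (N : 'M[R]_(m, n)) (s : 'I_m -> 'I_n) i j :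
  (\adj (colsub s N) *m N) i j = \det (colsub (fun k => if k == i then j else s k) N).
Proof.
rewrite (expand_det_col _ i) mxE; apply: eq_bigr => k _.
rewrite !mxE eqxx mulrC; congr (_ * _); rewrite /cofactor; congr (_ * \det _).
by apply/matrixP => a b; rewrite !mxE eq_sym (negbTE (neq_lift _ _)).
Qed.

(** After denominators are cleared, [s] selects a nonzero maximal minor of least valuation. By
    Cramer's rule the entries of [\adj (colsub s N) *m N] are maximal minors, hence multiples of the
    chosen one, and the quotient [B] is integral with the identity in columns [s]. *)
Lemma saturated_basis m n (M : 'M[Qp]_(m, n)) : row_free M ->
  exists (A : 'M[Zp]_(m, n)) (s : 'I_m -> 'I_n),
    colsub s A = 1%:M /\ (map_mx inc A :=: M)%MS.
Proof.
move=> freeM; have [a a0 [N NE]] := clear_denominators M.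
have inc_neq0 x : x != 0 -> inc x != 0 by rewrite tofrac_eq0.
have eqNM : (map_mx inc N :=: M)%MS by rewrite -NE; apply/eqmx_scale/inc_neq0.
have [s [Fs0 Fs]] : exists s : {ffun 'I_m -> 'I_n}, \det (colsub s N) != 0 /\
    forall t : {ffun 'I_m -> 'I_n}, exists z, \det (colsub t N) = z * \det (colsub s N).
  suff [s Fs0] : exists s : {ffun 'I_m -> 'I_n}, \det (colsub s N) != 0.
    have [|t t0 ht] := @Zpadic_dvd_all p p_pr {ffun 'I_m -> 'I_n}
      (fun s => \det (colsub s N)); first by exists s.
    by exists t.
  have full : row_full (map_mx inc N)^T by rewrite /row_full mxrank_tr eqNM.
  exists (fullrankfun full).
  have := fullrowsub_full full.
  rewrite row_full_unit unitmxE unitfE -trmx_mxsub -map_mxsub det_tr det_map_mx.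
  by apply: contraNneq => ->; rewrite rmorph0.
have hB (ij : 'I_m * 'I_n) : exists z,
    (\adj (colsub s N) *m N) ij.1 ij.2 = z * \det (colsub s N).
  have [z hz] := Fs [ffun k => if k == ij.1 then ij.2 else s k].
  by exists z; rewrite det_colsub_subst -hz mxsub_ffunr.
have [g hg] := choice hB; pose B := \matrix_(i, j) g (i, j).
have adjB : \adj (colsub s N) *m N = \det (colsub s N) *: B.
  by apply/matrixP => i j; rewrite (hg (i, j)) !mxE mulrC.
have sB : colsub s B = 1%:M.
  apply: (scalemx_inj Fs0); rewrite scalemx1 -mul_adj_mx mulmx_colsub adjB.
  by apply/matrixP => i j; rewrite !mxE.
have NB : N = colsub s N *m B.
  apply: (scalemx_inj Fs0); rewrite scalemxAr -adjB mulmxA mul_mx_adj.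
  by rewrite mul_scalar_mx.
(* [adjB] and [NB] give the two inclusions between the row spaces over Q_p. *)
exists B, s; split=> //; apply: eqmx_trans eqNM; apply/eqmxP/andP; split; last first.
  by rewrite NB map_mxM submxMl.
rewrite -(eqmx_scale _ (inc_neq0 _ Fs0)) -map_mxZ -adjB map_mxM submxMl //.
Qed.

Lemma vspace_basis n m (L : {vspace 'rV[Qp]_n}) : \dim L = m ->
  exists As : 'M[Zp]_(m, n) * ('I_m -> 'I_n),
    colsub As.2 As.1 = 1%:M /\ forall v, (v \in L) = (v <= map_mx inc As.1)%MS.
Proof.
move=> <-; pose M := \matrix_(i < \dim L) (vbasis L)`_i.
have mulM (u : 'rV_(\dim L)) : u *m M = \sum_i u 0 i *: (vbasis L)`_i.
  by rewrite mulmx_sum_row; apply: eq_bigr => i _; rewrite rowK.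
have freeM : row_free M.
  apply: inj_row_free => u; rewrite mulM => u0.
  have /freeP/(_ _ u0) h := basis_free (vbasisP L).
  by apply/rowP => i; rewrite h mxE.
have [A [s [sA AM]]] := saturated_basis freeM.
exists (A, s); split=> // v; rewrite AM; apply/idP/submxP => [vL|[u ->]].
  exists (\row_i coord (vbasis L) i v); rewrite mulM {1}(coord_vbasis vL).
  by apply: eq_bigr => i _; rewrite mxE.
rewrite mulM; apply: memv_suml => i _; apply: memvZ; apply: vbasis_mem.
by rewrite mem_nth // size_tuple.
Qed.

End SaturatedBases.

(** * Forms vanishing on a pencil over a finite ring *)

(** The sum of [hom_poly] over any ring, so that coefficients can be reduced. *)
Definition form (R : comNzRingType) n d (c : hom_monom n d -> R) : mpoly n R :=
  \sum_(alpha : hom_monom n d) c alpha *: mpolyX R (val alpha).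

(* The form f on the pencil spanned by the rows of A, dehomogenized:
   f(A_0 + 'X A_1). *)
Definition restrict (R : comNzRingType) n (A : 'M[R]_(2, n)) (f : mpoly n R) : {poly R} :=
  mmap polyC (fun i => (A 0 i)%:P + (A 1 i)%:P * 'X) f.

Section Forms.
Variables (R : comNzRingType) (n d : nat).
Implicit Types (c : hom_monom n d -> R) (A : 'M[R]_(2, n)).

HB.instance Definition _ A := GRing.RMorphism.copy (restrict A) (restrict A).

Lemma restrict_form A c : restrict A (form c) =
  \sum_(alpha : hom_monom n d)
    (c alpha)%:P * \prod_i ((A 0 i)%:P + (A 1 i)%:P * 'X) ^+ (val alpha : multinom n) i.
Proof.
rewrite rmorph_sum; apply: eq_bigr => alpha _.
by rewrite /= /restrict mmapZ mmapX.
Qed.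

Lemma homog_form (f : mpoly n R) : f \is ishomog1 d mdeg ->
  exists c : {ffun hom_monom n d -> R}, f = form c.
Proof.
move=> homf; exists [ffun alpha : hom_monom n d => mcoeff (val alpha) f].
have szf : (msize f <= d.+1)%N.
  rewrite msizeE; apply/bigmax_leqP_seq => m mf _ /=.
  by rewrite ltnS; move/dhomogP: homf => /(_ _ mf) ->.
rewrite {1}(mpolywE szf).
(* Monomials of degree other than [d] have coefficient zero; the rest are reindexed by
   [hom_monom n d]. *)
rewrite (bigID (fun m : bmultinom n d.+1 => mdeg m == d)) /= addrC big1 ?add0r.
  rewrite (reindex_omap (val : hom_monom n d -> bmultinom n d.+1) insub); last first.
    by move=> m mP; rewrite insubT.
  apply: eq_big => [alpha|alpha _]; first by rewrite (valP alpha) valK eqxx.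
  by rewrite ffunE.
move=> m mP; rewrite (_ : mcoeff _ _ = 0) ?scale0r //.
exact: dhomog_nemf_coeff mP.
Qed.

(** The columns of the right inverse [B] give linear forms [b 0] and [b 1] that restrict to 1 and
    ['X], so [F] restricts to the prescribed polynomial. *)
Lemma restrict_surj A (B : 'M[R]_(n, 2)) (g : {ffun 'I_d.+1 -> R}) : A *m B = 1%:M ->
  exists c : {ffun hom_monom n d -> R}, restrict A (form c) = \poly_(i < d.+1) g (inord i).
Proof.
move=> AB1.
pose b k : mpoly n R := \sum_j B j k *: mpolyX R (mnm1 j).
have rb k : restrict A (b k) = (0 == k)%:R%:P + (1 == k)%:R%:P * 'X.
  have AB i : \sum_j A i j * B j k = (i == k)%:R.
    by have := congr1 (fun M : 'M[R]_2 => M i k) AB1; rewrite !mxE.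
  rewrite rmorph_sum /= -!AB !rmorph_sum mulr_suml -big_split /=; apply: eq_bigr => j _.
  rewrite /restrict mmapZ mmapX mmap1U mulrDr mulrA -!rmorphM.
  by rewrite mulrC (mulrC (B j k) (A 1 j)).
have homb k : b k \is ishomog1 1 mdeg.
  apply: rpred_sum => j _; apply: rpredZ; rewrite dhomogX /=.
  by rewrite mdeg1.
pose F := \sum_(i < d.+1) g i *: (b 1 ^+ i * b 0 ^+ (d - i)).
have homF : F \is ishomog1 d mdeg.
  apply: rpred_sum => i _; apply: rpredZ.
  have /dhomogM/(_ (dhomogMn (d - i) (homb 0))) := dhomogMn i (homb 1).
  by rewrite !mul1n subnKC // -ltnS.
have [c cF] := homog_form homF; exists c; rewrite -cF rmorph_sum poly_def.
apply: eq_bigr => i _; rewrite /= {1}/restrict mmapZ -/(restrict _ _).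
rewrite rmorphM !rmorphXn /= !rb inord_val.
by rewrite !eqxx /= mul0r mul1r addr0 add0r expr1n mulr1 mul_polyC.
Qed.

End Forms.


Section Counting.
Variables (R : finComNzRingType) (n d : nat).
Implicit Types (c : {ffun hom_monom n d -> R}) (A : 'M[R]_(2, n)).

Lemma formD c c' : form (c + c') = form c + form c'.
Proof.
by rewrite /form -big_split /=; apply: eq_bigr => alpha _; rewrite ffunE scalerDl.
Qed.

Definition right_invertible A := [exists B : 'M[R]_(n, 2), A *m B == 1%:M].

Definition vanishing_forms A : {set {ffun hom_monom n d -> R}} :=
  [set c : {ffun hom_monom n d -> R} | restrict A (form c) == 0].

Definition vanishing_pencils c : {set 'M[R]_(2, n)} :=
  [set A | right_invertible A & restrict A (form c) == 0].

(** Let [G g] be a form restricting to [g]. From the sum of a vanishing form and [G g], restriction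
    recovers [g], and subtraction then recovers the form. *)
Lemma card_vanishing_forms A : right_invertible A ->
  (#|vanishing_forms A| * #|R| ^ d.+1 <=
     #|R| ^ #|{: hom_monom n d}|)%N.
Proof.
case/existsP => B /eqP AB1.
have [G hG] := choice (fun g => @restrict_surj R n d A B g AB1).
rewrite -card_ffun -[X in (_ * _ ^ X)%N]card_ord -card_ffun -cardsT -cardsX.
set D := finset.setX _ _.
suff /card_in_imset <- : {in D &, injective (fun cg => cg.1 + G cg.2)} by exact: max_card.
move=> [c g] [c' g']; rewrite !inE /= !andbT => /eqP c0 /eqP c'0 e.
have gg : g = g'.
  have := congr1 (fun c => restrict A (form c)) e.
  rewrite /= !formD !rmorphD /= c0 c'0 !add0r !hG => /polyP eg.
  apply/ffunP => i; have := eg i.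
  by rewrite !coef_poly ltn_ord inord_val.
by move: e; rewrite gg => /addIr ->.
Qed.

(** Double counting of pairs of a form and a pencil; the right-invertible pencils are bounded by all
    matrices. *)
Lemma sum_card_vanishing_pencils :
  ((\sum_c #|vanishing_pencils c|) * #|R| ^ d.+1 <=
     #|R| ^ (2 * n) * #|R| ^ #|{: hom_monom n d}|)%N.
Proof.
have -> : (\sum_c #|vanishing_pencils c| = \sum_(A | right_invertible A)
    #|vanishing_forms A|)%N.
  under eq_bigr do rewrite -sum1_card.
  under [RHS]eq_bigr do rewrite -sum1_card.
  rewrite (exchange_big_dep right_invertible) /=; last by move=> c A _ /[!inE] /andP[].
  by apply: eq_bigr => A hA; apply: eq_bigl => c; rewrite !inE hA.
rewrite big_distrl /= -card_mx -sum_nat_const big_mkcond /=.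
by apply: leq_sum => A _; case: ifP => // /card_vanishing_forms.
Qed.

End Counting.

(** * Lines and their reductions *)

Lemma restrict_map (R S : comNzRingType) (phi : {rmorphism R -> S}) n d
    (A : 'M[R]_(2, n)) (c : hom_monom n d -> R) :
  map_poly phi (restrict A (form c)) = restrict (map_mx phi A) (form (phi \o c)).
Proof.
rewrite !restrict_form rmorph_sum /=; apply: eq_bigr => alpha _.
rewrite rmorphM rmorph_prod /= map_polyC; congr (_ * _); apply: eq_bigr => i _.
by rewrite rmorphXn rmorphD rmorphM /= !map_polyC map_polyX !mxE.
Qed.

Definition unitmx_set (R : finComUnitRingType) n : {set 'M[R]_n} := [set G | G \in unitmx].

Section LinesModPowers.
Variables (p : nat) (p_pr : prime p) (n d : nat).
Notation Zp := (Zpadic p_pr).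
Notation Qp := (Qpadic p_pr).
Notation inc := (Zpadic_inc p_pr).
Notation W k := 'Z_(p ^ k.+1).
Notation red := (@Zpadic_red p p_pr).
Implicit Types (xi : hom_monom n.+1 d -> Zp) (L : {vspace 'rV[Qp]_n.+1}).

Lemma Zpadic_natr_inj : injective (fun i => i%:R : Zp).
Proof.
move=> i j /(congr1 (fun z => zres z (maxn i j))).
rewrite !zres_nat.
have lt_exp k : (k <= maxn i j)%N -> k%:Z < (p ^ maxn i j)%N%:Z.
  by move=> km; rewrite ltz_nat (leq_ltn_trans km) // ltn_expl // prime_gt1.
by rewrite !modz_small ?lt_exp ?leq_maxl ?leq_maxr // => -[].
Qed.

(** Every point [A_0 + x A_1] lies in [L], so the restricted polynomial vanishes at every [x]. The
    natural numbers below its size are then too many roots for a nonzero polynomial. *)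
Lemma restrict_eq0 xi L (A : 'M[Zp]_(2, n.+1)) : lines_on (hom_poly xi) L ->
  (forall v, (v <= map_mx inc A)%MS -> v \in L) -> restrict A (form xi) = 0.
Proof.
move=> [_ Lxi] AL.
have ev x : (restrict A (form xi)).[x] = 0.
  apply: Zpadic_inc_inj; rewrite rmorph0.
  pose u : 'rV[Zp]_2 := \row_i (if i == 0 then 1 else x).
  have /AL/Lxi <- : (map_mx inc (u *m A) <= map_mx inc A)%MS by rewrite map_mxM submxMl.
  have -> : map_mpoly inc (hom_poly xi) = form (inc \o xi).
    rewrite (raddf_sum (map_mpoly inc)); apply: eq_bigr => alpha _ /=.
    by rewrite map_mpolyZ map_mpolyX.
  rewrite restrict_form horner_sum rmorph_sum (raddf_sum (meval _)).
  apply: eq_bigr => alpha _ /=.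
  rewrite mevalZ mevalX hornerM hornerC rmorphM; congr (_ * _).
  rewrite horner_prod rmorph_prod; apply: eq_bigr => i _.
  rewrite horner_exp rmorphXn; congr (_ ^+ _).
  rewrite !hornerE !mxE big_ord_recl big_ord1 !mxE /= mul1r mulrC.
  by rewrite (_ : lift ord0 ord0 = 1) //; apply: val_inj.
apply/eqP; apply: contraT => f0.
have := @max_poly_roots _ (restrict A (form xi))
  [seq i%:R | i <- iota 0 (size (restrict A (form xi)))] f0.
rewrite size_map size_iota ltnn; apply.
  by apply/allP => x _; apply/rootP.
by rewrite map_inj_uniq ?iota_uniq //; exact: Zpadic_natr_inj.
Qed.

(** The identity in columns [s] of [A] forces [G] to be the reduction of [colsub s A']. Over Z_p,
    however, [A'] differs from [colsub s A' *m A], since equality would put [L'] inside [L]; an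
    entry where they differ is still different mod p^(k+1) for all large [k]. *)
Lemma red_basis_separated L L' (A A' : 'M[Zp]_(2, n.+1)) (s : 'I_2 -> 'I_n.+1) :
  colsub s A = 1%:M ->
  (forall v, (v \in L) = (v <= map_mx inc A)%MS) ->
  (forall v, (v \in L') = (v <= map_mx inc A')%MS) ->
  \dim L = \dim L' -> L != L' ->
  exists k0, forall k, (k0 <= k)%N -> forall G : 'M[W k]_2,
    map_mx (red k) A' != G *m map_mx (red k) A.
Proof.
move=> sA LA LA' dimL LL'.
have : A' != colsub s A' *m A.
  apply: contraNneq LL' => A'E; rewrite eq_sym eqEdim dimL leqnn andbT.
  apply/subvP => v; rewrite LA' LA A'E map_mxM => /submx_trans; apply.
  exact: submxMl.
have [[i j] ij|h] := pickP (fun ij => A' ij.1 ij.2 != (colsub s A' *m A) ij.1 ij.2); last first.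
  by case/eqP; apply/matrixP => i j; have /negbFE/eqP := h (i, j).
move=> _; have [k0 hk0] := Zpadic_red_neq ij.
exists k0 => k k0k G; apply: contraNneq hk0 => A'G; apply/eqP.
apply: (Zpadic_red_le k0k).
have GE : map_mx (red k) (colsub s A') = G.
  by rewrite map_mxsub A'G -mulmx_colsub -map_mxsub sA map_mx1 mulmx1.
have : map_mx (red k) A' = map_mx (red k) (colsub s A' *m A) by rewrite map_mxM GE.
by move/matrixP/(_ i j); rewrite !mxE.
Qed.

(** [F] sends a line and an invertible [G] to a pencil. For [k] beyond a bound depending on [ls],
    separation recovers the line from this pencil, and the identity minor then recovers [G]. *)
Lemma card_lines_le xi (ls : seq {vspace 'rV[Qp]_n.+1}) :
  uniq ls -> (forall L, L \in ls -> lines_on (hom_poly xi) L) ->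
  exists k0, forall k, (k0 <= k)%N ->
    (size ls * #|unitmx_set (W k) 2| <=
      #|vanishing_pencils [ffun alpha => red k (xi alpha)]|)%N.
Proof.
move=> uls ls_xi.
have h L : exists As : 'M[Zp]_(2, n.+1) * ('I_2 -> 'I_n.+1), \dim L = 2 ->
      colsub As.2 As.1 = 1%:M /\ forall v, (v \in L) = (v <= map_mx inc As.1)%MS.
  have [/vspace_basis[As hAs]|dL] := eqVneq (\dim L) 2; first by exists As.
  (* A dummy value in other dimensions lets [choice] give a total function. *)
  by exists (0, fun=> 0) => /eqP; rewrite (negbTE dL).
have [As hAs] := choice h.
have dim2 L : L \in ls -> \dim L = 2 by case/ls_xi.
pose A L := (As L).1; pose s L := (As L).2.
have sA L : L \in ls -> colsub (s L) (A L) = 1%:M by case/dim2/hAs.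
have LA L : L \in ls -> forall v, (v \in L) = (v <= map_mx inc (A L))%MS by case/dim2/hAs.
have hK (LL : {vspace 'rV[Qp]_n.+1} * {vspace 'rV[Qp]_n.+1}) : exists k0,
    LL.1 \in ls -> LL.2 \in ls -> LL.1 != LL.2 ->
    forall k, (k0 <= k)%N -> forall G : 'M[W k]_2,
    map_mx (red k) (A LL.2) != G *m map_mx (red k) (A LL.1).
  case: LL => L L' /=.
  have [Lls|] := boolP (L \in ls); last by exists 0%N.
  have [Lls'|] := boolP (L' \in ls); last by exists 0%N.
  have [|LL'] := eqVneq L L'; first by exists 0%N.
  have [|k0 hk0] := red_basis_separated (sA _ Lls) (LA _ Lls) (LA _ Lls') _ LL'.
    by rewrite !dim2.
  by exists k0.
have {hK}[K hK] := choice hK.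
exists (\max_(L <- ls) \max_(L' <- ls) K (L, L'))%N => k Kk.
have sep L L' : L \in ls -> L' \in ls -> L != L' ->
    forall G : 'M[W k]_2, map_mx (red k) (A L') != G *m map_mx (red k) (A L).
  move=> Lls Lls' LL'; apply: (hK (L, L')) => //; apply: leq_trans Kk.
  apply: leq_trans (leq_bigmax_seq (F := fun L => \max_(L' <- ls) K (L, L'))%N L Lls isT).
  exact: (leq_bigmax_seq (F := fun L' => K (L, L')) L' Lls' isT).
pose N L : 'M[W k]_(2, n.+1) := map_mx (red k) (A L).
pose U := unitmx_set (W k) 2.
pose D := finset.setX [set: 'I_(size ls)]%SET U.
pose F (iG : 'I_(size ls) * 'M[W k]_2) := iG.2 *m N (tnth (in_tuple ls) iG.1).
have tls i : tnth (in_tuple ls) i \in ls by exact: mem_tnth.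
have sN L : L \in ls -> colsub (s L) (N L) = 1%:M.
  by move=> Lls; rewrite -map_mxsub sA // map_mx1.
have injF : {in D &, injective F}.
  move=> [i G] [j H]; rewrite !inE /= => uG uH GH.
  have ij : i = j.
    apply/eqP; apply: contraT => ij.
    have LL : tnth (in_tuple ls) i != tnth (in_tuple ls) j 
      by have /tuple_uniqP tinj : uniq (in_tuple ls) := uls; rewrite (inj_eq tinj).
    have := sep _ _ (tls i) (tls j) LL (invmx H *m G).
    move: GH; rewrite /F /N /= -mulmxA => ->; rewrite mulKmx ?eqxx //.
  subst j; congr (_, _).
  have := congr1 (colsub (s (tnth (in_tuple ls) i))) GH.
  by rewrite /F /= -!mulmx_colsub sN // !mulmx1.
have -> : (size ls * #|U| = #|F @: D|)%N.
  by rewrite card_in_imset // cardsX cardsT card_ord.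
apply: subset_leq_card; apply/fintype.subsetP => _ /imsetP[[i G] + ->].
rewrite !inE /= => uG; set L := tnth (in_tuple ls) i; rewrite /F /= -/L.
have Lls : L \in ls by exact: tls.
apply/andP; split.
  apply/existsP; exists (colsub (s L) 1%:M *m invmx G).
  by rewrite mulmxA mulmx_colsub mulmx1 -mulmx_colsub sN // mulmx1 mulmxV.
(* With an entrywise lift [G'] of [G], the rows of [G' *m A L] lie in [L], so the form vanishes on
   this pencil before reduction. *)
have [g hg] := choice (@Zpadic_red_surj p p_pr k).
pose G' := map_mx g G.
have GE : G = map_mx (red k) G' by apply/matrixP => a b; rewrite !mxE hg.
have := restrict_eq0 (ls_xi _ Lls) (A := G' *m A L).
rewrite map_mxM => {}h.
have {}h : restrict (G' *m A L) (form xi) = 0.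
  by apply: h => v vGA; rewrite LA //; apply: submx_trans vGA _; exact: submxMl.
rewrite GE -map_mxM; have := restrict_map (red k) (G' *m A L) xi.
rewrite h rmorph0 => ->.
apply/eqP; congr restrict.
by rewrite /form; apply: eq_bigr => alpha _; rewrite ffunE.
Qed.

End LinesModPowers.

(** * Haar measure and expectation *)

Section EqualBlocks.
Variables (d : measure_display) (E : measurableType d) (R : realType).
Variables (mu : {measure set E -> \bar R}) (I : finType) (F : I -> set E).

Lemma measure_equal_blocks (m : \bar R) (S : {set I}) :
  (forall i, measurable (F i)) -> trivIset setT F -> (forall i, mu (F i) = m) ->
  mu (\bigcup_(i in [set` S]) F i) = (#|S|%:R%:E * m)%E.
Proof.
move=> mF tF Fm; rewrite measure_fin_bigcup //; last exact: sub_trivIset tF.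
have -> : [set` S] = [set` enum S].
  by apply/seteqP; split=> i /=; rewrite mem_enum.
rewrite -fsbig_seq ?enum_uniq // big_enum /=.
under eq_bigr do rewrite Fm.
by rewrite sumr_const mule_natl.
Qed.
End EqualBlocks.

Section Fibers.
Variables (p : nat) (p_pr : prime p) (k : nat).
Notation Zp := (Zpadic p_pr).
Notation Qp := (Qpadic p_pr).
Notation inc := (Zpadic_inc p_pr).
Notation W := 'Z_(p ^ k.+1).
Notation red := (@Zpadic_red p p_pr k).

Definition Zp_fiber (w : W) : set Zp := [set x | red x = w].

Definition mx_fiber m n (w : 'M[W]_(m, n)) : set 'M[Qp]_(m, n) :=
  [set map_mx inc A | A in [set A | map_mx red A = w]].

Lemma measurable_Zp_fiber w : (measurable : set (set (borel Zp))) (Zp_fiber w).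
Proof.
apply: sub_sigma_algebra.
suff : padic_open (@idfun Zp) (Zp_fiber w) by [].
move=> x xw; exists k.+1 => z.
by rewrite /Zp_fiber /= rmorphD /= Zpadic_red_expn addr0.
Qed.

(** The class is a box of entrywise classes, each stable under adding p^(k+1) Z_p, hence open. *)
Lemma measurable_mx_fiber m n (w : 'M[W]_(m, n)) :
  (measurable : set (set (borel 'M[Qp]_(m, n)))) (mx_fiber w).
Proof.
apply: sub_sigma_algebra; rewrite /= openE => _ [A Aw <-].
exists (fun i j => inc @` Zp_fiber (w i j)) => [i j|M hM].
  rewrite mxE; apply: open_nbhs_nbhs; split.
    2: by exists (A i j) => //; rewrite -Aw /Zp_fiber /= mxE.
  suff : padic_open inc (inc @` Zp_fiber (w i j)) by [].
  move=> _ [x xw <-]; exists k.+1 => z; exists (x + p%:R ^+ k.+1 * z).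
    by rewrite /Zp_fiber /= rmorphD /= Zpadic_red_expn addr0.
  by rewrite rmorphD rmorphM rmorphXn rmorph_nat.
have hM' ij : exists a, red a = w ij.1 ij.2 /\ inc a = M ij.1 ij.2.
  by have [a ? ?] := hM ij.1 ij.2; exists a.
have [g hg] := choice hM'; exists (\matrix_(i, j) g (i, j)).
  by apply/matrixP => i j; rewrite !mxE; have [] := hg (i, j).
by apply/matrixP => i j; rewrite !mxE; have [] := hg (i, j).
Qed.

Lemma trivIset_Zp_fiber : trivIset setT Zp_fiber.
Proof. by move=> v w _ _ [x [/= <- <-]]. Qed.

Lemma trivIset_mx_fiber m n : trivIset setT (@mx_fiber m n).
Proof.
move=> v w _ _ [_ [[A <- <-] [B <- BA]]]; congr map_mx.
apply/matrixP => i j; apply: (@Zpadic_inc_inj p p_pr).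
by move/matrixP/(_ i j): BA; rewrite !mxE.
Qed.

Lemma Zp_fiber_translate x w : [set x + y | y in Zp_fiber w] = Zp_fiber (red x + w).
Proof.
apply/seteqP; split=> [_ [y /= yw <-]|y /= yw].
  by rewrite /Zp_fiber /= rmorphD /= yw.
exists (y - x); last by rewrite addrC subrK.
by rewrite /Zp_fiber /= rmorphB /= yw addrC addKr.
Qed.

Lemma mx_fiber_translate m n (A : 'M[Zp]_(m, n)) w :
  [set map_mx inc A + M | M in mx_fiber w] = mx_fiber (map_mx red A + w).
Proof.
apply/seteqP; split=> [_ [_ [B Bw <-] <-]|_ [B Bw <-]].
  by exists (A + B); rewrite ?map_mxD // /= map_mxD Bw.
exists (map_mx inc (B - A)); last by rewrite -map_mxD addrC subrK.
by exists (B - A) => //=; rewrite map_mxB Bw addrC addKr.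
Qed.

Lemma bigcup_Zp_fiber : \bigcup_(w in [set` [set: W]%SET]) Zp_fiber w = setT.
Proof. by apply/seteqP; split=> // x _; exists (red x); rewrite //= finset.in_setT. Qed.

Lemma bigcup_mx_fiber m n :
  \bigcup_(w in [set` [set: 'M[W]_(m, n)]%SET]) mx_fiber w = @integral_mx p p_pr m n.
Proof.
apply/seteqP; split=> [_ [w _ [A _ <-]]|_ [A _ <-]]; first by exists A.
by exists (map_mx red A); [rewrite /= finset.in_setT|exists A].
Qed.

(** A determinant is a unit exactly when its reduction is, so GL_n(Z_p) is a union of residue
    classes at every level [k]. *)
Lemma bigcup_unit_fiber n :
  \bigcup_(w in [set` unitmx_set W n]) mx_fiber w = @GL_padic p p_pr n.
Proof.
have redU (A : 'M[Zp]_n) : (map_mx red A \in unitmx) = (A \in unitmx).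
  by rewrite !unitmxE det_map_mx Zpadic_red_unit.
apply/seteqP; split=> [_ [w uw [A Aw <-]]|_ [A uA <-]].
  by exists A => //=; rewrite -redU Aw; move: uw; rewrite /= inE.
by exists (map_mx red A); [rewrite /= inE redU|exists A].
Qed.

Variables (R : realType).

(** The p^(k+1) classes are disjoint translates covering Z_p and share the mass 1 equally. *)
Lemma haar_Zp_fiber (mu : {measure set (borel Zp) -> \bar R}) w :
  haar_measure (measurable : set (set (borel Zp))) setT mu ->
  mu (Zp_fiber w) = ((p ^ k.+1)%N%:R^-1)%:E.
Proof.
move=> [mu1 mut].
have mu0 v : mu (Zp_fiber v) = mu (Zp_fiber 0).
  have [x <-] := Zpadic_red_surj p_pr v.
  rewrite -[in LHS](addr0 (red x)) -Zp_fiber_translate; apply: mut.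
  exact: measurable_Zp_fiber.
have := measure_equal_blocks [set: W]%SET measurable_Zp_fiber trivIset_Zp_fiber mu0.
rewrite bigcup_Zp_fiber mu1 cardsT card_Zpadic_red // mu0 => /esym.
have q0 : (p ^ k.+1)%N%:R != 0 :> R by rewrite pnatr_eq0 -lt0n ltnW // expn_prime_gt1.
by move=> /(congr1 (mule ((p ^ k.+1)%N%:R^-1)%:E)); rewrite muleA -EFinM mulVf // mul1e mule1.
Qed.

(** Each of the q^4 classes, q = p^(k+1), has mass q^-4. The fraction is thus independent of [k],
    and its inverse is the bound on the expectation of [N_k(f)]. *)
Lemma haar_GL (lambda : {measure set (borel 'M[Qp]_(2, 2)) -> \bar R}) :
  haar_measure (measurable : set (set (borel 'M[Qp]_(2, 2))))
    (@integral_mx p p_pr 2 2) lambda ->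
  lambda (@GL_padic p p_pr 2) = (#|unitmx_set W 2|%:R / ((p ^ k.+1) ^ 4)%N%:R)%:E.
Proof.
move=> [l1 lt].
have l0 v : lambda (mx_fiber v) = lambda (mx_fiber 0).
  have [g hg] := choice (Zpadic_red_surj p_pr (k := k)).
  have <- : map_mx red (map_mx g v) = v by apply/matrixP => i j; rewrite !mxE hg.
  rewrite -[in LHS](addr0 (map_mx red _)) -mx_fiber_translate; apply: lt.
  exact: measurable_mx_fiber.
have hS S := measure_equal_blocks S (@measurable_mx_fiber 2 2) (@trivIset_mx_fiber 2 2) l0.
have q0 : ((p ^ k.+1) ^ 4)%N%:R != 0 :> R.
  by rewrite pnatr_eq0 -lt0n expn_gt0 ltnW // expn_prime_gt1.
have := hS [set: 'M[W]_(2, 2)]%SET.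
rewrite bigcup_mx_fiber l1 cardsT card_mx card_Zpadic_red // => /esym.
move=> /(congr1 (mule (((p ^ k.+1) ^ 4)%N%:R^-1)%:E)).
rewrite muleA -EFinM mulVf // mul1e mule1 => m0.
by rewrite -bigcup_unit_fiber hS m0 EFinM.
Qed.

End Fibers.

(** * Expected number of vanishing pencils mod p^(k+1) *)

Section ExpectedPencils.
Variables (p : nat) (p_pr : prime p) (k n d : nat).
Variables (d0 : measure_display) (Omega : measurableType d0) (R : realType).
Variables (P : probability Omega R).
Variable xi : hom_monom n d -> {RV P >-> borel (Zpadic p_pr)}.
Hypothesis xi_unif : iid_uniform xi.
Notation W := 'Z_(p ^ k.+1).
Notation red := (@Zpadic_red p p_pr k).

Definition red_coefs (w : Omega) : {ffun hom_monom n d -> W} :=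
  [ffun alpha => red (xi alpha w)].

(** The random variable [N_k(f)], extended-real valued for Fatou's lemma. *)
Definition pencil_count (w : Omega) : \bar R :=
  (#|vanishing_pencils (red_coefs w)|%:R / #|unitmx_set W 2|%:R)%:E.

Lemma red_coefs_fiber c : red_coefs @^-1` [set c] =
  \bigcap_(alpha in [set` [set: hom_monom n d]%SET])
    (xi alpha @^-1` @Zp_fiber p p_pr k (c alpha)).
Proof.
apply/seteqP; split=> [w /= wc alpha _|w h /=].
  by rewrite /Zp_fiber /= -wc ffunE.
by apply/ffunP => alpha; rewrite ffunE h //= finset.in_setT.
Qed.

Lemma measurable_red_coefs c : measurable (red_coefs @^-1` [set c]).
Proof.
rewrite red_coefs_fiber; apply: fin_bigcap_measurable => // alpha _.
by apply: measurable_funPTI; exact: measurable_Zp_fiber.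
Qed.

(** Each reduced coefficient is uniform on Z/p^(k+1), and independence multiplies the
    probabilities. *)
Lemma probability_red_coefs c : P (red_coefs @^-1` [set c]) =
  (((p ^ k.+1) ^ #|{: hom_monom n d}|)%N%:R^-1)%:E.
Proof.
have [indep unif] := xi_unif.
rewrite red_coefs_fiber (indep _ (fun alpha => @Zp_fiber p p_pr k (c alpha))); last first.
  by move=> alpha _; exact: measurable_Zp_fiber.
transitivity ((\prod_(alpha : hom_monom n d) ((p ^ k.+1)%N%:R^-1 : R))%:E).
  rewrite -prodEFin; apply: eq_big => [alpha|alpha _]; first by rewrite finset.in_setT.
  exact: (haar_Zp_fiber _ (unif alpha)).
by rewrite prodr_const exprVn -natrX; congr (_ _).
Qed.

(** [red_coefs] has finitely many values, so the count is a finite combination of indicators and can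
    be integrated termwise. *)
Lemma pencil_countE w : pencil_count w =
  (\sum_(c : {ffun hom_monom n d -> W})
    (#|vanishing_pencils c|%:R / #|unitmx_set W 2|%:R)%:E *
      (\1_(red_coefs @^-1` [set c]) w)%:E)%E.
Proof.
rewrite (bigD1 (red_coefs w)) //= big1 ?adde0 => [|c cw].
  by rewrite indicE mem_set // mule1.
by rewrite indicE memNset ?mule0 //= => wc; rewrite -wc eqxx in cw.
Qed.

Let count_ge0 (c : {ffun hom_monom n d -> W}) :
  0 <= #|vanishing_pencils c|%:R / #|unitmx_set W 2|%:R :> R.
Proof. by rewrite divr_ge0. Qed.

Let measurable_term (c : {ffun hom_monom n d -> W}) :
  measurable_fun [set: Omega] (fun w =>
    (#|vanishing_pencils c|%:R / #|unitmx_set W 2|%:R)%:E *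
      (\1_(red_coefs @^-1` [set c]) w : R)%:E)%E.
Proof.
apply: measurable_funeM; apply/measurable_EFinP.
by apply: measurable_indic; exact: measurable_red_coefs.
Qed.

Lemma measurable_pencil_count : measurable_fun [set: Omega] pencil_count.
Proof.
rewrite (funext pencil_countE).
exact: emeasurable_sum.
Qed.

(** The expectation is an average over all coefficient vectors, bounded by the double count. With
    [n] variables there are at most q^(2n) pencils, each imposing d+1 conditions mod q; the
    hypothesis leaves the factor q^4. *)
Lemma expected_pencil_count : (2 * n = d.+1 + 4)%N ->
  (\int[P]_w pencil_count w <= (((p ^ k.+1) ^ 4)%N%:R / #|unitmx_set W 2|%:R)%:E)%E.
Proof.
move=> nd.
under eq_integral do rewrite pencil_countE.
rewrite ge0_integral_sum //.
rewrite (eq_bigr (fun c => (#|vanishing_pencils c|%:R / #|unitmx_set W 2|%:R *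
    ((p ^ k.+1) ^ #|{: hom_monom n d}|)%N%:R^-1)%:E)) => [|c _]; last first.
  rewrite ge0_integralZl_EFin //; last first.
    by apply/measurable_EFinP/measurable_indic; exact: measurable_red_coefs.
  rewrite integral_indic ?setIT //; last exact: measurable_red_coefs.
  by rewrite [RHS]EFinM; congr mule; exact: probability_red_coefs.
rewrite sumEFin lee_fin.
have q0 m : (0 < (p ^ k.+1) ^ m)%N by rewrite expn_gt0 ltnW // expn_prime_gt1.
rewrite -!mulr_suml -natr_sum mulrAC ler_wpM2r ?invr_ge0 //.
rewrite ler_pdivrMr ?ltr0n // -natrM ler_nat.
have := @sum_card_vanishing_pencils W n d.
rewrite card_Zpadic_red // nd [(_ ^ (_ + _))%N]expnD => h.
rewrite -(@leq_pmul2r ((p ^ k.+1) ^ d.+1)) ?q0 //.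
by apply: leq_trans h _; rewrite -mulnA mulnC.
Qed.

End ExpectedPencils.

(* f need not be measurable: the integral of a nonnegative function is a
   supremum over the simple functions below it. *)
Lemma le_integral_nonmeasurable (d : measure_display) (T : measurableType d)
    (R : realType) (mu : {measure set T -> \bar R}) (f g : T -> \bar R) :
  (forall x, 0 <= f x)%E -> (forall x, f x <= g x)%E ->
  (\int[mu]_x f x <= \int[mu]_x g x)%E.
Proof.
move=> f0 fg; have g0 x : (0 <= g x)%E by exact: le_trans (f0 x) (fg x).
rewrite !ge0_integralTE //; apply: ereal_sup_le => _ [h /= hf <-].
by exists h => //= x; exact: le_trans (hf x) (fg x).
Qed.

Lemma limn_einf_ge (R : realType) (u : (\bar R)^nat) (l : \bar R) k0 :
  (forall k, (k0 <= k)%N -> l <= u k)%E -> (l <= limn_einf u)%E.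
Proof.
move=> lu; rewrite limn_einf_lim; apply: lime_ge; first exact: is_cvg_einfs.
exists k0 => // k /= k0k; apply: le_ereal_inf_tmp => _ [m /= km <-].
by apply: lu; exact: leq_trans km.
Qed.

Lemma limn_esup_le (R : realType) (u : (\bar R)^nat) (l : \bar R) k0 :
  (forall k, (k0 <= k)%N -> u k <= l)%E -> (limn_esup u <= l)%E.
Proof.
move=> lu; rewrite limn_esup_lim; apply: lime_le; first exact: is_cvg_esups.
exists k0 => // k /= k0k; apply: ge_ereal_sup => _ [m /= km <-].
by apply: lu; exact: leq_trans km.
Qed.

(** An infinite set has finite subsets of every size, which forces [l] to be infinite. This reduces
    the count of lines to finite lists. *)
Lemma counting_le (T : choiceType) (R : realType) (X : set T) (l : \bar R) :
  (forall s : seq T, uniq s -> (forall x, x \in s -> X x) -> (size s)%:R%:E <= l)%E ->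
  (counting X <= l)%E.
Proof.
move=> h; rewrite /counting; case: asboolP => [fX|iX].
  apply: h; first exact: fset_uniq.
  by move=> x; rewrite in_fset_set // => /set_mem.
suff -> : l = +oo%E by [].
apply/eqyP => r r0.
have [B BX nB] := infinite_set_fset (Num.truncn r).+1 iX.
apply: le_trans (h B _ _); [|exact: fset_uniq|by move=> x xB; exact: BX].
rewrite lee_fin ltW // (lt_le_trans (truncnS_gt r)) // ler_nat //.
Qed.

(** * From pencils to lines by Fatou's lemma *)

Section ExpectedLines.
Variables (p : nat) (p_pr : prime p) (n d : nat).
Variables (d0 : measure_display) (Omega : measurableType d0) (R : realType).
Variables (P : probability Omega R).
Variable xi : hom_monom n.+1 d -> {RV P >-> borel (Zpadic p_pr)}.
Hypothesis xi_unif : iid_uniform xi.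

(** The threshold [k0] varies with the finite list of lines; the lower limit absorbs it. *)
Lemma counting_lines_le w :
  (counting (lines_on (hom_poly (fun alpha => xi alpha w))) <=
    limn_einf (fun k => pencil_count k xi w))%E.
Proof.
apply: counting_le => ls uls ls_on.
have [k0 hk0] := card_lines_le uls ls_on.
apply: (@limn_einf_ge _ _ _ k0) => k /hk0 h.
rewrite lee_fin ler_pdivlMr; first by rewrite -natrM ler_nat.
rewrite ltr0n card_gt0; apply/set0Pn; exists 1%:M.
by rewrite inE unitmx1.
Qed.

Lemma expected_lines_le (b : \bar R) : (2 * n.+1 = d.+1 + 4)%N ->
  (forall k, (((p ^ k.+1) ^ 4)%N%:R / #|unitmx_set 'Z_(p ^ k.+1) 2|%:R)%:E <= b)%E ->
  (\int[P]_w counting (lines_on (hom_poly (fun alpha => xi alpha w))) <= b)%E.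
Proof.
move=> nd hb.
apply: le_trans (le_integral_nonmeasurable P _ counting_lines_le) _.
  by move=> w; rewrite /counting; case: ifP => _ //; rewrite lee_fin.
apply: le_trans (@fatou _ _ _ P setT measurableT (fun k => pencil_count k xi) _ _) _.
- by move=> k; exact: measurable_pencil_count.
- by move=> k w _; rewrite lee_fin divr_ge0.
apply: le_trans (limn_einf_sup _) (@limn_esup_le _ _ _ 0 _) => k _.
by apply: le_trans (hb k); exact: expected_pencil_count.
Qed.

End ExpectedLines.

Theorem theorem20 (R : realType) (p : nat) (p_pr : prime p)
  (lambda : {measure set (borel 'M[Qpadic p_pr]_(2, 2)) -> \bar R})
  (lambda_haar : haar_measure (measurable : set (set (borel 'M[Qpadic p_pr]_(2, 2))))
                   (@integral_mx p p_pr 2 2) lambda)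
  (d : nat -> measure_display) (Omega : forall n, measurableType (d n))
  (P : forall n, probability (Omega n) R)
  (xi : forall n, hom_monom n.+1 (2 * n - 3)%N ->
          {RV (P n) >-> borel (Zpadic p_pr)})
  (xi_unif : forall n, (2 <= n)%N -> iid_uniform (xi n)) :
  (limn_esup (fun n => \int[P n]_w
      counting (lines_on (hom_poly (fun alpha => xi n alpha w))))
    <= 1 / lambda (@GL_padic p p_pr 2))%E.
Proof.
(* From index 2 on, the law is uniform and the truncated subtraction [2 * n - 3] is exact. *)
apply: (@limn_esup_le _ _ _ 2) => n n2.
apply: (expected_lines_le (xi_unif n n2)) => [|k].
  by lia.
(* The measure of GL_2(Z_p) is a nonzero real, so its extended-real inverse is the ordinary one and
   equals the bound at level [k]. *)
rewrite (haar_GL k lambda_haar) div1e inver ifF ?invf_div //.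
apply/negbTE; rewrite mulf_neq0 ?invr_neq0 // pnatr_eq0.
  rewrite -lt0n card_gt0; apply/set0Pn; exists 1%:M.
  by rewrite inE unitmx1.
by rewrite -lt0n expn_gt0 ltnW // expn_prime_gt1.
Qed.
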